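(* Let $(L,\otimes,u)$ be a commutative unital quantale. An $L$-ordered set $(P,e)$ is a continuous $L$-dcpo if and only if there exists an interpolative generalized $L$-closure space $(X,\langle\cdot\rangle)$ such that $(\mathfrak{C}(X),\mathrm{sub})\cong(P,e)$.
   Context: Quantale: $(L,\otimes,u)$ is a complete lattice with bottom $0$ and top $1$, with an associative commutative operation $\otimes$ with unit $u$, distributing over arbitrary joins; $\to$ is its residuation, i.e. $a\otimes b\le c\iff a\le b\to c$. An $L$-subset of $X$ is a map $A:X\to L$; $L^X$ is ordered pointwise. For $x\in X$, $u_x\in L^X$ is given by $u_x(x)=u$ and $u_x(y)=0$ for $y\ne x$. $\mathrm{sub}(A,B)=\bigwedge_{x\in X}(A(x)\to B(x))$ for $A,B\in L^X$. $L$-orders: an $L$-ordered set is a set $P$ with $e:P\times P\to L$ such that $e(x,x)\ge u$; $e(x,y)\otimes e(y,z)\le e(x,z)$; and $e(x,y)\wedge e(y,x)\ge u$ implies $x=y$. Any subset of $L^X$ is an $L$-ordered set under $\mathrm{sub}$. $P\cong Q$ means there is a bijection $f:P\to Q$ with $e_P(x,y)=e_Q(f(x),f(y))$ for all $x,y$. An element $x_0$ is the supremum $\sqcup A$ of $A\in L^P$ if $e(x_0,y)=\bigwedge_{x\in P}(A(x)\to e(x,y))$ for all $y\in P$. $D\in L^P$ is directed if $\bigvee_{x\in P}D(x)\ge u$ and $D(x)\otimes D(y)\le\bigvee_{z\in P}D(z)\otimes e(x,z)\otimes e(y,z)$ for all $x,y$. $D\in L^P$ is a lower set if $D(x)\otimes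 e(y,x)\le D(y)$ for all $x,y$; an ideal is a directed lower set; $\mathcal{I}_L(P)$ is the set of ideals. $P$ is an $L$-dcpo if every directed $L$-subset has a supremum. For an $L$-dcpo $P$ and $x\in P$, define $\Downarrow x\in L^P$ by $\Downarrow x(y)=\bigwedge_{I\in\mathcal{I}_L(P)}(e(x,\sqcup I)\to I(y))$. An $L$-dcpo $P$ is a continuous $L$-dcpo if for every $x\in P$, $\Downarrow x$ is directed and $\sqcup\Downarrow x=x$. Closure spaces: a generalized $L$-closure space $(X,\langle\cdot\rangle)$ is a set $X$ with $\langle\cdot\rangle:L^X\to L^X$ such that $\mathrm{sub}(A,B)\le\mathrm{sub}(\langle A\rangle,\langle B\rangle)$ and $\langle\langle A\rangle\rangle\le\langle A\rangle$ for all $A,B\in L^X$. It is interpolative if for all $x,y,a,b\in X$: (IT1) $\bigvee_{t\in X}\langle u_x\rangle(t)\ge u$; (IT2) $\langle u_x\rangle(y)\le\bigvee_{t\in X}\langle u_x\rangle(t)\otimes\langle u_t\rangle(y)$; (IT3) $\langle u_x\rangle(a)\otimes\langle u_x\rangle(b)\le\bigvee_{t\in X}\langle u_x\rangle(t)\otimes\langle u_t\rangle(a)\otimes\langle u_t\rangle(b)$. A directed closed set of an interpolative generalized $L$-closure space is $U\in L^X$ such that for all $x,y\in X$: (DC1) $\bigvee_{x\in X}U(x)\ge u$; (DC2) $U(x)\le\mathrm{sub}(\langle u_x\rangle,U)$; (DC3) $U(x)\le\bigvee_{y\in X}U(y)\otimes\langle u_y\rangle(x)$; (DC4) $U(x)\otimes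 U(y)\le\bigvee_{z\in X}U(z)\otimes\langle u_z\rangle(x)\otimes\langle u_z\rangle(y)$. $\mathfrak{C}(X)$ is the set of all directed closed sets. *)

(* Defs.v *)
From HB Require Import structures.
From mathcomp Require Import all_boot all_order.
From mathcomp Require Import boolp classical_sets.

Set Implicit Arguments.
Unset Strict Implicit.
Unset Printing Implicit Defensive.

Import Order.TTheory.
Local Open Scope order_scope.

(* The lattice operations, \bot and \top are determined by the order, so that
   a complete lattice is a bounded lattice in which every subset has a
   supremum. *)
HB.mixin Record TBLattice_isComplete d L of Order.TBLattice d L := {
  joins : set L -> L;
  joinsP : forall A : set L, supremums A (joins A)
}.

#[short(type="completeLatticeType")]
HB.structure Definition CompleteLattice d :=
  { L of Order.TBLattice d L & TBLattice_isComplete d L }.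

Section CompleteLatticeTheory.
Context {d : Order.disp_t} {L : completeLatticeType d}.

Definition meets (A : set L) : L := joins (lbound A).

Lemma meetsP (A : set L) : infimums A (meets A).
Proof.
have [ub_lb le_ub] := joinsP (lbound A).
split=> // x Ax; apply: le_ub => y; exact.
Qed.

Definition ijoin (I : Type) (F : I -> L) : L := joins (range F).
Definition imeet (I : Type) (F : I -> L) : L := meets (range F).

Lemma ijoin_leP (I : Type) (F : I -> L) (a : L) :
  ijoin F <= a <-> forall i, F i <= a.
Proof.
have [ubF leF] := joinsP (range F); split=> [Fa i|Fa].
  by apply: le_trans Fa; apply: ubF; exists i.
by apply: leF => _ [i _ <-].
Qed.

Lemma le_imeetP (I : Type) (F : I -> L) (a : L) :
  a <= imeet F <-> forall i, a <= F i.
Proof.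
have [lbF geF] := meetsP (range F); split=> [aF i|aF].
  by apply: le_trans aF _; apply: lbF; exists i.
by apply: geF => _ [i _ <-].
Qed.

End CompleteLatticeTheory.

Notation "\bigvee_ i F" := (ijoin (fun i => F%O))
  (at level 60, i at level 0, F at level 60, right associativity,
   format "\bigvee_ i  F") : order_scope.
Notation "\bigvee_ ( i : T ) F" := (ijoin (fun i : T => F%O))
  (at level 60, i at level 50, F at level 60, right associativity,
   only parsing) : order_scope.
Notation "\bigwedge_ i F" := (imeet (fun i => F%O))
  (at level 60, i at level 0, F at level 60, right associativity,
   format "\bigwedge_ i  F") : order_scope.
Notation "\bigwedge_ ( i : T ) F" := (imeet (fun i : T => F%O))
  (at level 60, i at level 50, F at level 60, right associativity,
   only parsing) : order_scope.

HB.mixin Record CompleteLattice_isQuantale d L of CompleteLattice d L := {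
  tensor : L -> L -> L;
  qunit : L;
  tensorA : associative tensor;
  tensorC : commutative tensor;
  tensor1q : left_id qunit tensor;
  tensor_joinsr : forall (a : L) (B : set L),
    tensor a (joins B) = joins [set tensor a b | b in B]%classic
}.

#[short(type="quantaleType")]
HB.structure Definition Quantale d :=
  { L of CompleteLattice d L & CompleteLattice_isQuantale d L }.

Definition resid {d : Order.disp_t} {L : quantaleType d} (a b : L) : L :=
  joins [set c | tensor a c <= b]%classic.

Notation "a \ox b" := (tensor a b)
  (at level 40, left associativity) : order_scope.
Notation "a \res b" := (resid a b)
  (at level 41, right associativity) : order_scope.

Section QuantaleTheory.
Context {d : Order.disp_t} {L : quantaleType d}.
Implicit Types a b c : L.

Lemma le_tensorr a b c : b <= c -> a \ox b <= a \ox c.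
Proof.
move=> bc; have -> : c = joins [set b; c]%classic.
  have [ub lb] := joinsP [set b; c]%classic.
  apply/le_anti/andP; split; first by apply: ub; right.
  by apply: lb => _ [->|->].
rewrite tensor_joinsr.
by have [ub _] := joinsP [set a \ox x | x in [set b; c]]%classic;
   apply: ub; exists b => //; left.
Qed.

Lemma residP a b c : a \ox b <= c <-> b <= a \res c.
Proof.
have [ub lb] := joinsP [set x | a \ox x <= c]%classic.
split=> [abc|bac]; first exact: ub.
apply: le_trans (le_tensorr a bac) _; rewrite tensor_joinsr.
by have [_ lb'] := joinsP [set a \ox x | x in [set x | a \ox x <= c]]%classic;
   apply: lb' => _ [x /= xc <-].
Qed.

End QuantaleTheory.

Section LSubsets.
Context {d : Order.disp_t} {L : quantaleType d} {X : Type}.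

Definition pt (x : X) : X -> L := fun y => if `[< y = x >] then qunit else \bot.

Definition Lsub (A B : X -> L) : L := \bigwedge_(x : X) A x \res B x.

Lemma le_LsubP (A B : X -> L) :
  qunit <= Lsub A B <-> forall x, A x <= B x.
Proof.
rewrite /Lsub le_imeetP; split=> AB x.
  by rewrite -[A x]tensor1q tensorC residP.
by rewrite -residP tensorC tensor1q.
Qed.

Lemma Lsub_refl (A : X -> L) : qunit <= Lsub A A.
Proof. by apply/le_LsubP. Qed.

Lemma Lsub_trans (A B C : X -> L) : Lsub A B \ox Lsub B C <= Lsub A C.
Proof.
apply/le_imeetP => x; rewrite -residP tensorA.
have AB : A x \ox Lsub A B <= B x by rewrite residP; move: x; apply/le_imeetP.
have BC : B x \ox Lsub B C <= C x by rewrite residP; move: x {AB}; apply/le_imeetP.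
apply: le_trans BC; rewrite ![_ \ox Lsub B C]tensorC.
exact: le_tensorr.
Qed.

Lemma Lsub_anti (A B : X -> L) : qunit <= Lsub A B `&` Lsub B A -> A = B.
Proof.
rewrite lexI => /andP[/le_LsubP AB /le_LsubP BA].
by apply/funext => x; apply/le_anti; rewrite AB BA.
Qed.

Lemma Lsub_sig_anti (S : set (X -> L)) (A B : {A : X -> L | S A}) :
  qunit <= Lsub (sval A) (sval B) `&` Lsub (sval B) (sval A) -> A = B.
Proof. by move: A B => [A SA] [B SB] /= /Lsub_anti AB; apply: eq_exist. Qed.

End LSubsets.

Record lordset (d : Order.disp_t) (L : quantaleType d) := LOrdSet {
  lcarrier :> Type;
  le_L : lcarrier -> lcarrier -> L;
  le_L_refl : forall x, qunit <= le_L x x;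
  le_L_trans : forall x y z, le_L x y \ox le_L y z <= le_L x z;
  le_L_anti : forall x y, qunit <= le_L x y `&` le_L y x -> x = y
}.

Definition sub_lordset (d : Order.disp_t) (L : quantaleType d) (X : Type)
    (S : set (X -> L)) : lordset L :=
  @LOrdSet d L {A : X -> L | S A}
    (fun A B => Lsub (sval A) (sval B))
    (fun A => Lsub_refl (sval A))
    (fun A B C => Lsub_trans (sval A) (sval B) (sval C))
    (@Lsub_sig_anti d L X S).

Definition liso (d : Order.disp_t) (L : quantaleType d) (P Q : lordset L) :
    Prop :=
  exists2 f : P -> Q, bijective f & forall x y, le_L x y = le_L (f x) (f y).

Section LDcpo.
Context {d : Order.disp_t} {L : quantaleType d} {P : lordset L}.

Definition is_lsup (A : P -> L) (s : P) : Prop :=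
  forall y, le_L s y = \bigwedge_(x : P) A x \res le_L x y.

Definition directed (D : P -> L) : Prop :=
  qunit <= \bigvee_x D x /\
  forall x y, D x \ox D y <= \bigvee_z D z \ox le_L x z \ox le_L y z.

Definition lower (D : P -> L) : Prop := forall x y, D x \ox le_L y x <= D y.

Definition ideal (D : P -> L) : Prop := directed D /\ lower D.

End LDcpo.

Definition ldcpo (d : Order.disp_t) (L : quantaleType d) (P : lordset L) :
    Prop :=
  forall D : P -> L, directed D -> exists s, is_lsup D s.

Section ContinuousLDcpo.
Context {d : Order.disp_t} {L : quantaleType d} {P : lordset L}.

(* Suprema are unique, by antisymmetry, so the choice is harmless. *)
Definition lsup (dcpoP : ldcpo P) (D : P -> L) (dirD : directed D) : P :=
  sval (cid (dcpoP D dirD)).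

Definition way_below (dcpoP : ldcpo P) (x y : P) : L :=
  \bigwedge_(I : {I : P -> L | ideal I})
    le_L x (lsup dcpoP (svalP I).1) \res sval I y.

End ContinuousLDcpo.

(* way_below dcpoP x y is the degree to which y is way below x, i.e.,
   way_below dcpoP x is the L-subset usually written with a double down-arrow
   in front of x. *)
Definition continuous_ldcpo (d : Order.disp_t) (L : quantaleType d)
    (P : lordset L) : Prop :=
  exists dcpoP : ldcpo P, forall x : P,
    directed (way_below dcpoP x) /\ is_lsup (way_below dcpoP x) x.

Record gen_closure_space (d : Order.disp_t) (L : quantaleType d) :=
  GenClosureSpace {
    gcarrier :> Type;
    cl : (gcarrier -> L) -> (gcarrier -> L);
    cl_sub : forall A B, Lsub A B <= Lsub (cl A) (cl B);
    cl_cl : forall A x, cl (cl A) x <= cl A x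
  }.

Section Interpolative.
Context {d : Order.disp_t} {L : quantaleType d} (X : gen_closure_space L).

Local Notation "<< x >>" := (cl (pt (x : X))).

Definition interpolative : Prop :=
  forall x y a b : X,
  [/\ qunit <= \bigvee_t << x >> t,
      << x >> y <= \bigvee_t << x >> t \ox << t >> y
    & << x >> a \ox << x >> b <=
        \bigvee_t << x >> t \ox << t >> a \ox << t >> b].

(* The first condition stands outside the quantifiers, so that it is not
   vacuous when X is empty. *)
Definition directed_closed (U : X -> L) : Prop :=
  [/\ qunit <= \bigvee_x U x,
      forall x, U x <= Lsub << x >> U,
      forall x, U x <= \bigvee_y U y \ox << y >> x
    & forall x y, U x \ox U y <= \bigvee_z U z \ox << z >> x \ox << z >> y].

Definition dclosed_lordset : lordset L :=
  sub_lordset [set U | directed_closed U]%classic.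

End Interpolative.

(* Main.v *)
Require Import Defs.
From mathcomp Require Import all_boot all_order.
From HB Require Import structures.
From mathcomp Require Import ssrAC boolp classical_sets.

(** Both directions read a continuous L-dcpo through an L-valued relation that
is transitive and interpolative.

From the order to the space, the points of the space are those of [P] and the
closure of [A] at [y] is [\bigvee_x A x \ox w x y], where [w x y] is the degree
to which [y] is way below [x].  The closure of the point [x] is then [w x], so
the interpolation axioms are the interpolation property of the way-below
relation.  That property ([way_below_interpolation]) holds because the
[w]-lower set generated by [w x] is an ideal whose supremum is still [x], and
an ideal whose supremum is [x] contains everything way below [x].  The
directed closed sets turn out to be exactly the [w x]: such a set [U] is an
ideal, so it contains everything way below its supremum, and conversely each
of its points is way below another of its points, hence way below the
supremum.

From the space to the order, write [k x] for the closure of the point [x].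
The relation [k] is transitive, so every [k x] is a directed closed set.  A
directed join of directed closed sets is directed closed, hence is their
supremum.  A directed closed set [U] is the join of the [k x] weighted by
[U x]; the lower set generated by these [k x] is an ideal with supremum [U].
If [U] is below the supremum of another ideal, then a point [x] of [U] belongs
to some member of that ideal, because the supremum is a pointwise join, and so
[k x] is below that member.  The first ideal is thus contained in the second,
and an ideal with these properties is necessarily the set of elements way
below [U] ([continuous_ldcpoI]).

Throughout, an isomorphism from the directed closed sets to [P] is used in the
form of an isometric family of subsets, indexed by [P], that runs through all
directed closed sets ([liso_dclosedP]); so nothing has to be transported from
one L-ordered set to another. *)

Set Implicit Arguments.
Unset Strict Implicit.
Unset Printing Implicit Defensive.

Import Order.TTheory.
Local Open Scope order_scope.

(** * Tensors, joins and inclusion degrees *)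

HB.instance Definition _ (d : Order.disp_t) (L : quantaleType d) :=
  Monoid.isComLaw.Build L qunit (@tensor d L) tensorA tensorC tensor1q.

Section TensorJoins.
Context {d : Order.disp_t} {L : quantaleType d}.
Implicit Types a b c : L.

Lemma tensorq1 a : a \ox qunit = a.
Proof. by rewrite tensorC tensor1q. Qed.

Lemma le_tensor a b a' b' : a <= a' -> b <= b' -> a \ox b <= a' \ox b'.
Proof.
move=> aa' bb'; apply: le_trans (le_tensorr a bb') _.
by rewrite ![_ \ox b']tensorC; exact: le_tensorr.
Qed.

Lemma le_tensor_unitr a b : qunit <= b -> a <= a \ox b.
Proof. by move=> ub; rewrite -{1}[a]tensorq1; exact: le_tensorr. Qed.

Lemma le_ijoin (I : Type) (F : I -> L) (i : I) a : a <= F i -> a <= ijoin F.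
Proof. by move=> aF; apply: le_trans aF _; move: i; apply/ijoin_leP. Qed.

Lemma ijoin_tensor_le (I : Type) (F : I -> L) b c :
  ijoin F \ox b <= c <-> forall i, F i \ox b <= c.
Proof.
have FbE i : (F i \ox b <= c) = (b \ox F i <= c) by rewrite tensorC.
rewrite tensorC residP ijoin_leP.
by split=> Fc i; move: (Fc i); rewrite FbE residP.
Qed.

(** The device by which a bound by a join is used: the bounded factor is
traded for an arbitrary term of the join. *)
Lemma tensor_cut (I : Type) (F : I -> L) a b c :
  a <= ijoin F -> (forall i, F i \ox b <= c) -> a \ox b <= c.
Proof.
move=> aF Fc; apply: (le_trans (le_tensor aF (lexx b))).
exact/ijoin_tensor_le.
Qed.

(** Existence of weight at least the unit lets one pick a term for free. *)
Lemma unit_cut (I : Type) (F : I -> L) b c :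
  qunit <= ijoin F -> (forall i, F i \ox b <= c) -> b <= c.
Proof. by move=> uF Fc; rewrite -[b]tensor1q; exact: tensor_cut Fc. Qed.

End TensorJoins.

Section Inclusion.
Context {d : Order.disp_t} {L : quantaleType d} {X : Type}.
Implicit Types A B : X -> L.

Lemma le_Lsub a A B : a <= Lsub A B <-> forall x, A x \ox a <= B x.
Proof. by rewrite le_imeetP; split=> aAB x; move: (aAB x); rewrite residP. Qed.

Lemma Lsub_tensor A B x : A x \ox Lsub A B <= B x.
Proof. by move: x; apply/le_Lsub. Qed.

Lemma Lsub_pt (x : X) A : Lsub (pt x) A = A x.
Proof.
apply/le_anti/andP; split.
  have := Lsub_tensor (pt x) A x.
  by rewrite /pt; case: asboolP => // _; rewrite tensor1q.
apply/le_Lsub => y; rewrite /pt; case: asboolP => [->|_].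
  by rewrite tensor1q.
by rewrite tensorC residP le0x.
Qed.

End Inclusion.

Section OrderFacts.
Context {d : Order.disp_t} {L : quantaleType d} {P : lordset L}.
Implicit Types (D : P -> L) (x y s t : P).

Lemma is_lsup_unique D s t : is_lsup D s -> is_lsup D t -> s = t.
Proof.
move=> Ds Dt; have st y : le_L s y = le_L t y by rewrite Ds Dt.
by apply: le_L_anti; rewrite lexI st le_L_refl -st le_L_refl.
Qed.

Lemma is_lsup_ub D s x : is_lsup D s -> D x <= le_L x s.
Proof.
move=> Ds; have := Lsub_tensor D (fun z => le_L z s) x; apply: le_trans.
by apply: le_tensor_unitr; rewrite -[Lsub _ _]Ds le_L_refl.
Qed.

End OrderFacts.

(** * The way-below relation *)

Section WayBelow.
Context {d : Order.disp_t} {L : quantaleType d} {P : lordset L}.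
Variable dcpoP : ldcpo P.
Implicit Types (x y z s : P) (I : P -> L) (a : L).

Local Notation w := (way_below dcpoP).

(** Frees the way-below degree from the chosen suprema: suprema are unique, so
any supremum of the ideal serves. *)
Lemma le_way_belowP x y a :
  a <= w x y <->
  forall I s, ideal I -> is_lsup I s -> le_L x s \ox a <= I y.
Proof.
rewrite le_imeetP; split=> [aw I s idI Is|aI [I idI]].
  have /residP := aw (exist _ I idI) => /=.
  by rewrite /lsup (is_lsup_unique (svalP (cid _)) Is).
by apply/residP; apply: aI => //=; exact: svalP (cid _).
Qed.

Lemma way_below_ideal x y I s :
  ideal I -> is_lsup I s -> le_L x s \ox w x y <= I y.
Proof. by move=> idI Is; move: I s idI Is; apply/le_way_belowP. Qed.

Lemma way_below_lower x y z : w x y \ox le_L z y <= w x z.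
Proof.
apply/le_way_belowP => I s idI Is; rewrite tensorA.
apply: le_trans (idI.2 y z); apply: le_tensor => //.
exact: way_below_ideal Is.
Qed.

Lemma way_below_mono x y z : w x z \ox le_L x y <= w y z.
Proof.
apply/le_way_belowP => I s idI Is.
apply: le_trans (way_below_ideal x z idI Is).
rewrite tensorA (ACl ((3*1)*2)) /=; apply: le_tensor => //.
exact: le_L_trans.
Qed.

(** An ideal that approximates each point [x] from inside every ideal whose
supremum is above [x] is the way-below subset of [x], because it is itself one
of the ideals over which the latter is an infimum. *)
Lemma way_below_unique x I :
  ideal I -> is_lsup I x ->
  (forall J s, ideal J -> is_lsup J s ->
     forall y, I y \ox le_L x s <= J y) ->
  w x = I.
Proof.
move=> idI Ix IJ; apply/funext => y; apply/le_anti/andP; split.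
  apply: le_trans (way_below_ideal x y idI Ix).
  by rewrite tensorC; apply: le_tensor_unitr; exact: le_L_refl.
by apply/le_way_belowP => J s idJ Js; rewrite tensorC; exact: IJ.
Qed.

End WayBelow.

Lemma continuous_ldcpoI (d : Order.disp_t) (L : quantaleType d)
    (P : lordset L) :
  ldcpo P ->
  (forall x, exists I : P -> L, [/\ ideal I, is_lsup I x &
     forall J s, ideal J -> is_lsup J s ->
       forall y, I y \ox le_L x s <= J y]) ->
  continuous_ldcpo P.
Proof.
move=> dcpoP approx; exists dcpoP => x; have [I [idI Ix IJ]] := approx x.
by rewrite (way_below_unique dcpoP idI Ix IJ); split=> //; exact: idI.1.
Qed.

Section Interpolation.
Context {d : Order.disp_t} {L : quantaleType d} {P : lordset L}.
Variable dcpoP : ldcpo P.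
Local Notation w := (way_below dcpoP).
Hypothesis w_directed : forall x, directed (w x).
Hypothesis w_lsup : forall x, is_lsup (w x) x.
Implicit Types x y z a b s t : P.

Lemma way_below_le x y : w x y <= le_L y x.
Proof. exact: is_lsup_ub. Qed.

Lemma way_below_trans x y z : w x y \ox w y z <= w x z.
Proof.
rewrite tensorC; apply: le_trans (way_below_mono dcpoP y x z).
by apply: le_tensor => //; exact: way_below_le.
Qed.

(** Two interpolants [s] and [t] are replaced by a common one above both.
Each of [a] and [b] brings its own interpolant, as the tensor is not
idempotent and one interpolant could not be spent twice. *)
Lemma way_below_join_interpolants x a b s t :
  (w x s \ox w s a) \ox (w x t \ox w t b) <=
  \bigvee_r w x r \ox w r a \ox w r b.
Proof.
rewrite !tensorA (ACl ((1*3)*2*4)) /= -[_ \ox w t b]tensorA.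
apply: (tensor_cut ((w_directed x).2 s t)) => r.
apply: (le_ijoin (i := r)); rewrite !tensorA (ACl (1*(4*2)*(5*3))) /=.
by do 2?[apply: le_tensor => //]; exact: way_below_mono.
Qed.

(** The lower set generated by [w x] through the way-below relation itself. *)
Definition way_below2 x y : L := \bigvee_t w x t \ox w t y.

Lemma way_below2_ideal x : ideal (way_below2 x).
Proof.
split; [split|].
- apply: (unit_cut (w_directed x).1) => t.
  rewrite tensorC; apply: (tensor_cut (w_directed t).1) => y.
  by rewrite tensorC; apply: (le_ijoin (i := y)); apply: (le_ijoin (i := t)).
- move=> a b; apply/ijoin_tensor_le => s; rewrite tensorC.
  apply/ijoin_tensor_le => t.
  apply: le_trans (way_below_join_interpolants x b a t s) _.
  apply/ijoin_leP => r; rewrite (ACl ((3*2)*1)) /=.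
  apply: (tensor_cut ((w_directed r).2 a b)) => c.
  apply: (le_ijoin (i := c)); rewrite (ACl ((4*1)*2*3)) /=.
  by do 2?[apply: le_tensor => //]; exact: (le_ijoin (i := r)).
- move=> a b; apply/ijoin_tensor_le => t; apply: (le_ijoin (i := t)).
  by rewrite -tensorA; apply: le_tensorr; exact: way_below_lower.
Qed.

(** An upper bound of all [z] way below some [t] way below [x] is above each
[t], as the supremum of [w t], and therefore above [x], as that of [w x]. *)
Lemma way_below2_lsup x : is_lsup (way_below2 x) x.
Proof.
move=> y; apply/le_anti/andP; split.
  apply/le_Lsub => z; apply/ijoin_tensor_le => t.
  apply: le_trans (le_L_trans z x y); apply: le_tensor => //.
  exact: le_trans (way_below_trans x t z) (way_below_le x z).
rewrite (w_lsup x y); apply/le_Lsub => t; rewrite (w_lsup t y).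
apply/le_Lsub => z; rewrite tensorA.
apply: le_trans (Lsub_tensor (way_below2 x) (fun v => le_L v y) z).
apply: le_tensor => //.
by apply: (le_ijoin (i := t)); rewrite tensorC.
Qed.

(** By definition, [w x] lies inside every ideal whose supremum is [x]. *)
Lemma way_below_interpolation x y : w x y <= \bigvee_t w x t \ox w t y.
Proof.
apply: le_trans (way_below_ideal dcpoP x y (way_below2_ideal x)
                   (way_below2_lsup x)).
by rewrite tensorC; apply: le_tensor_unitr; exact: le_L_refl.
Qed.

Lemma way_below_interpolation2 x a b :
  w x a \ox w x b <= \bigvee_t w x t \ox w t a \ox w t b.
Proof.
apply: (tensor_cut (way_below_interpolation x a)) => s; rewrite tensorC.
apply: (tensor_cut (way_below_interpolation x b)) => t; rewrite tensorC.
exact: way_below_join_interpolants.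
Qed.

End Interpolation.

(** * Point closures and families representing the directed closed sets *)

Section PointClosures.
Context {d : Order.disp_t} {L : quantaleType d} {X : gen_closure_space L}.
Local Notation k x := (cl (pt (x : X))).

(** The degree [k x y] is the degree to which the point [y] is contained in
[k x], so this is monotonicity and idempotence of the closure. *)
Lemma le_cl_pt_Lsub (x y : X) : k x y <= Lsub (k y) (k x).
Proof.
rewrite -[k x y]Lsub_pt; apply: le_trans (cl_sub _ _) _.
apply/le_Lsub => z; exact: le_trans (Lsub_tensor _ _ z) (cl_cl _ _).
Qed.

Lemma cl_pt_directed_closed (x : X) : interpolative X -> directed_closed (k x).
Proof.
move=> iX; split=> [|y|y|a b].
- by have [] := iX x x x x.
- exact: le_cl_pt_Lsub.
- by have [] := iX x y x x.
- by have [] := iX x x a b.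
Qed.

Lemma directed_closed_down (U : X -> L) x y :
  directed_closed U -> U x \ox k x y <= U y.
Proof.
by move=> [_ + _ _] => /(_ x) /le_Lsub /(_ y); rewrite tensorC.
Qed.

End PointClosures.

Section Representation.
Context {d : Order.disp_t} {L : quantaleType d}.

Definition represents (X : gen_closure_space L) (P : lordset L)
    (U : P -> X -> L) : Prop :=
  [/\ forall p, directed_closed (U p),
      forall V, directed_closed V -> exists p, U p = V
    & forall p q, le_L p q = Lsub (U p) (U q)].

(** An isometric family is injective by antisymmetry of the L-order, so a
surjective one yields a bijection. *)
Lemma liso_dclosedP (X : gen_closure_space L) (P : lordset L) :
  liso (dclosed_lordset X) P <-> exists U : P -> X -> L, represents U.
Proof.
split=> [[f [g fK gK] fE]|[U [Udc Uonto UE]]].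
  exists (fun p => sval (g p)); split=> [p|V Vdc|p q]; first exact: svalP (g p).
  - by exists (f (exist _ V Vdc)); rewrite fK.
  - by rewrite -{1}[p]gK -{1}[q]gK -fE.
pose f (V : dclosed_lordset X) : P := sval (cid (Uonto _ (svalP V))).
have fU V : U (f V) = sval V by rewrite /f; case: cid.
exists f => [|V W]; last by rewrite UE !fU.
pose g p : dclosed_lordset X := exist _ (U p) (Udc p).
exists g => [[V Vdc]|p]; first by apply: eq_exist; exact: fU (exist _ V Vdc).
by apply: le_L_anti; rewrite lexI !UE fU /= !Lsub_refl.
Qed.

End Representation.

(** * From continuous L-dcpos to closure spaces *)

Section WayBelowSpace.
Context {d : Order.disp_t} {L : quantaleType d} {P : lordset L}.
Variable dcpoP : ldcpo P.
Local Notation w := (way_below dcpoP).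
Hypothesis w_directed : forall x, directed (w x).
Hypothesis w_lsup : forall x, is_lsup (w x) x.

Definition way_below_cl (A : P -> L) (y : P) : L := \bigvee_x A x \ox w x y.

Lemma way_below_cl_sub A B : Lsub A B <= Lsub (way_below_cl A) (way_below_cl B).
Proof.
apply/le_Lsub => y; apply/ijoin_tensor_le => x; apply: (le_ijoin (i := x)).
rewrite (ACl ((1*3)*2)) /=; apply: le_tensor => //; exact: Lsub_tensor.
Qed.

Lemma way_below_cl_cl A y : way_below_cl (way_below_cl A) y <= way_below_cl A y.
Proof.
apply/ijoin_leP => x; apply/ijoin_tensor_le => z; apply: (le_ijoin (i := z)).
by rewrite -tensorA; apply: le_tensorr; exact: way_below_trans.
Qed.

Definition way_below_space : gen_closure_space L :=
  GenClosureSpace way_below_cl_sub way_below_cl_cl.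

Lemma way_below_cl_pt x : @cl d L way_below_space (pt x) = w x.
Proof.
apply/funext => y; apply/le_anti/andP; split.
  apply/ijoin_leP => z; rewrite /pt; case: asboolP => [->|_].
    by rewrite tensor1q.
  by rewrite tensorC residP le0x.
apply: (le_ijoin (i := x)); rewrite /pt; case: asboolP => // _.
by rewrite tensor1q.
Qed.

Lemma way_below_space_interpolative : interpolative way_below_space.
Proof.
move=> x y a b; rewrite way_below_cl_pt; split; first exact: (w_directed x).1.
- apply: le_trans (way_below_interpolation w_directed w_lsup x y) _.
  apply/ijoin_leP => t; apply: (le_ijoin (i := t)).
  by rewrite way_below_cl_pt.
- apply: le_trans (way_below_interpolation2 w_directed w_lsup x a b) _.
  apply/ijoin_leP => t; apply: (le_ijoin (i := t)).
  by rewrite way_below_cl_pt.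
Qed.

Lemma way_below_directed_closed x : @directed_closed d L way_below_space (w x).
Proof.
split; first exact: (w_directed x).1.
- move=> y; rewrite way_below_cl_pt; apply/le_Lsub => z.
  by rewrite tensorC; exact: way_below_trans.
- move=> y; have [_ + _] := way_below_space_interpolative x y y y.
  by rewrite way_below_cl_pt.
- move=> a b; have [_ _] := way_below_space_interpolative x x a b.
  by rewrite way_below_cl_pt.
Qed.

Lemma directed_closed_ideal (U : P -> L) :
  @directed_closed d L way_below_space U -> ideal U.
Proof.
move=> Udc; have [U1 _ U3 U4] := Udc; split; [split=> // x y|move=> x y].
  apply: le_trans (U4 x y) _; apply/ijoin_leP => z; apply: (le_ijoin (i := z)).
  rewrite way_below_cl_pt.
  by do 2?[apply: le_tensor => //]; exact: way_below_le.
apply: (tensor_cut (U3 x)) => z; rewrite way_below_cl_pt -tensorA.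
apply: le_trans (le_tensorr (U z) (way_below_lower dcpoP z x y)) _.
by rewrite -(way_below_cl_pt z); exact: directed_closed_down.
Qed.

(** Surjectivity compares [U] with [w s] for [s] the supremum of [U]; the
isometry holds because [w] is monotone and [x] is the supremum of [w x]. *)
Lemma way_below_represents : @represents d L way_below_space P w.
Proof.
split; first exact: way_below_directed_closed.
- move=> U Udc; have idU := directed_closed_ideal Udc.
  have [s Us] := dcpoP idU.1; exists s; apply/funext => x.
  apply/le_anti/andP; split.
    apply: le_trans (way_below_ideal dcpoP s x idU Us).
    by rewrite tensorC; apply: le_tensor_unitr; exact: le_L_refl.
  have [_ _ U3 _] := Udc; apply: le_trans (U3 x) _; apply/ijoin_leP => y.
  rewrite way_below_cl_pt tensorC.
  apply: le_trans (way_below_mono dcpoP y s x); apply: le_tensorr.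
  exact: is_lsup_ub.
- move=> x y; apply/le_anti/andP; split.
    by apply/le_Lsub => z; exact: way_below_mono.
  rewrite (w_lsup x y); apply/le_Lsub => z.
  exact: le_trans (Lsub_tensor _ _ z) (way_below_le w_lsup y z).
Qed.

End WayBelowSpace.

(** * From closure spaces to continuous L-dcpos *)

Section RepresentedOrder.
Context {d : Order.disp_t} {L : quantaleType d} {X : gen_closure_space L}.
Context {P : lordset L} {U : P -> X -> L}.
Hypothesis iX : interpolative X.
Hypothesis Urep : represents U.
Local Notation k x := (cl (pt (x : X))).

Let U_closed p : directed_closed (U p).
Proof. by have [] := Urep. Qed.

Let le_LE p q : le_L p q = Lsub (U p) (U q).
Proof. by have [] := Urep. Qed.

Lemma represents_le p q x : U p x \ox le_L p q <= U q x.
Proof. by rewrite le_LE; exact: Lsub_tensor. Qed.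

Definition weighted_join (D : P -> L) (x : X) : L := \bigvee_p D p \ox U p x.

(** The last condition is where directedness of [D] acts: points [x] of [U p]
and [y] of [U q] both lie in [U r] for some [r] above [p] and [q], and there
they have a common source [z]. *)
Lemma weighted_join_directed_closed D :
  directed D -> directed_closed (weighted_join D).
Proof.
move=> [D1 D2]; split=> [|x|x|x y].
- apply: (unit_cut D1) => p; have [U1 _ _ _] := U_closed p.
  rewrite tensorC; apply: (tensor_cut U1) => x; rewrite tensorC.
  by apply: (le_ijoin (i := x)); apply: (le_ijoin (i := p)).
- apply/le_Lsub => y; rewrite tensorC; apply/ijoin_tensor_le => p.
  apply: (le_ijoin (i := p)); rewrite -tensorA; apply: le_tensorr.
  exact: directed_closed_down.
- apply/ijoin_leP => p; rewrite tensorC; have [_ _ U3 _] := U_closed p.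
  apply: (tensor_cut (U3 x)) => y; apply: (le_ijoin (i := y)).
  rewrite (ACl ((3*1)*2)) /=; apply: le_tensor => //.
  exact: (le_ijoin (i := p)).
- apply/ijoin_tensor_le => p; rewrite tensorC.
  apply/ijoin_tensor_le => q.
  rewrite !tensorA (ACl ((3*1)*4*2)) /= -[_ \ox U q y]tensorA.
  apply: (tensor_cut (D2 p q)) => r; rewrite !tensorA (ACl ((4*2)*(5*3)*1)) /=.
  apply: le_trans (le_tensor (le_tensor (represents_le p r x)
                                        (represents_le q r y)) (lexx _)) _.
  have [_ _ _ U4] := U_closed r.
  apply: (tensor_cut (U4 x y)) => z; apply: (le_ijoin (i := z)).
  rewrite (ACl ((4*1)*2*3)) /=; do 2?[apply: le_tensor => //].
  exact: (le_ijoin (i := r)).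
Qed.

(** The inclusion degree of a join is the infimum of those of its terms, so a
pointwise join is a supremum as soon as it is represented. *)
Lemma weighted_join_lsup D s : U s = weighted_join D -> is_lsup D s.
Proof.
move=> Us q; rewrite le_LE Us; apply/le_anti/andP; split.
  apply/le_Lsub => p; rewrite le_LE; apply/le_Lsub => x.
  rewrite tensorA; apply: le_trans (Lsub_tensor (weighted_join D) (U q) x).
  by apply: le_tensor => //; apply: (le_ijoin (i := p)); rewrite tensorC.
apply/le_Lsub => x; apply/ijoin_tensor_le => p.
rewrite (ACl (2*(1*3))) /=; apply: le_trans (represents_le p q x).
apply: le_tensorr; exact: Lsub_tensor.
Qed.

Lemma represents_ldcpo : ldcpo P.
Proof.
have [_ Uonto _] := Urep => D /weighted_join_directed_closed /Uonto [s Us].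
by exists s; exact: weighted_join_lsup.
Qed.

Lemma represents_lsup D s : directed D -> is_lsup D s -> U s = weighted_join D.
Proof.
have [_ Uonto _] := Urep => dirD Ds.
have [t Ut] := Uonto _ (weighted_join_directed_closed dirD).
by rewrite (is_lsup_unique Ds (weighted_join_lsup Ut)).
Qed.

(** The order degree between [p] and the point closure [k x], expressed without
choosing the element of [P] that represents [k x]. *)
Definition le_cl (p : P) (x : X) : L := Lsub (U p) (k x).

(** The lower set generated by the point closures, weighted by membership of
their points in [U p]. *)
Definition approximants (p q : P) : L := \bigvee_x U p x \ox le_cl q x.

Let cl_rep x : exists c, U c = k x.
Proof.
by have [_ Uonto _] := Urep; apply: Uonto; exact: cl_pt_directed_closed.
Qed.

Lemma le_cl_mono p x z : le_cl p x \ox k z x <= le_cl p z.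
Proof.
apply: le_trans (le_tensorr _ (le_cl_pt_Lsub z x)) _; exact: Lsub_trans.
Qed.

(** Directedness comes from that of [U p]: for points [x] and [y] of [U p] with
[q] below [k x] and [r] below [k y], a point [z] of [U p] whose closure
contains both gives the common upper bound [k z]. *)
Lemma approximants_ideal p : ideal (approximants p).
Proof.
have [U1 _ _ U4] := U_closed p; split; [split|].
- apply: (le_trans U1); apply/ijoin_leP => x.
  have [c Uc] := cl_rep x; apply: (le_ijoin (i := c)).
  apply: (le_ijoin (i := x)); apply: le_tensor_unitr.
  by rewrite /le_cl Uc Lsub_refl.
- move=> q r; apply/ijoin_tensor_le => x; rewrite tensorC.
  apply/ijoin_tensor_le => y; rewrite !tensorA (ACl ((3*1)*(2*4))) /=.
  apply: (tensor_cut (U4 x y)) => z.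
  have [c Uc] := cl_rep z; apply: (le_ijoin (i := c)).
  rewrite !tensorA (ACl (1*(5*2)*(4*3))) /=.
  apply: le_tensor; first apply: le_tensor.
  + apply: (le_ijoin (i := z)); apply: le_tensor_unitr.
    by rewrite /le_cl Uc Lsub_refl.
  + by rewrite le_LE Uc; exact: le_cl_mono.
  + by rewrite le_LE Uc; exact: le_cl_mono.
- move=> q r; apply/ijoin_tensor_le => x; apply: (le_ijoin (i := x)).
  rewrite -tensorA; apply: le_tensorr; rewrite tensorC le_LE; exact: Lsub_trans.
Qed.

Lemma approximants_lsup p : is_lsup (approximants p) p.
Proof.
apply: weighted_join_lsup; apply/funext => x; apply/le_anti/andP; split.
  have [_ _ U3 _] := U_closed p; apply: le_trans (U3 x) _.
  apply/ijoin_leP => y; have [c Uc] := cl_rep y.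
  apply: (le_ijoin (i := c)); rewrite Uc; apply: le_tensor => //.
  apply: (le_ijoin (i := y)); apply: le_tensor_unitr.
  by rewrite /le_cl Uc Lsub_refl.
apply/ijoin_leP => q; apply/ijoin_tensor_le => y.
rewrite -tensorA [le_cl q y \ox _]tensorC.
apply: le_trans (le_tensorr _ (Lsub_tensor _ _ x)) _.
exact: directed_closed_down.
Qed.

(** Since [U s] is the join of the [U r] weighted by [I r], a point [x] of
[U s] belongs to some [U r]; then [k x] is below [r], hence so is everything
below [k x]. *)
Lemma approximants_way_below p I s :
  ideal I -> is_lsup I s ->
  forall q, approximants p q \ox le_L p s <= I q.
Proof.
move=> idI Is q; apply/ijoin_tensor_le => x.
rewrite (ACl ((1*3)*2)) /=.
apply: le_trans (le_tensor (represents_le p s x) (lexx _)) _.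
rewrite (represents_lsup idI.1 Is); apply/ijoin_tensor_le => r.
apply: le_trans (idI.2 r q); rewrite -tensorA; apply: le_tensorr.
rewrite tensorC le_LE; apply: le_trans (Lsub_trans _ (k x) _).
by apply: le_tensorr; have [_ U2 _ _] := U_closed r; exact: U2.
Qed.

Lemma represents_continuous : continuous_ldcpo P.
Proof.
apply: continuous_ldcpoI represents_ldcpo _ => p; exists (approximants p).
split; [exact: approximants_ideal|exact: approximants_lsup|].
exact: approximants_way_below.
Qed.

End RepresentedOrder.

Theorem theorem3p11 (d : Order.disp_t) (L : quantaleType d) (P : lordset L) :
  continuous_ldcpo P <->
  exists X : gen_closure_space L, interpolative X /\ liso (dclosed_lordset X) P.
Proof.
split=> [[dcpoP contP]|[X [iX /liso_dclosedP [U Urep]]]].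
  have w_directed x := (contP x).1.
  have w_lsup x := (contP x).2.
  exists (way_below_space w_lsup); split.
    exact: way_below_space_interpolative.
  by apply/liso_dclosedP; exists (way_below dcpoP); exact: way_below_represents.
exact: represents_continuous Urep.
Qed.
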